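(* Let $t\in\mathbb{C}_\infty$ with $|t|<q$. Then for every $z\in\mathbb{C}_\infty$ the series $$\sum_{j=0}^\infty b_j(\chi_t)\frac{e_j(z)}{D_j}$$ converges in $\mathbb{C}_\infty$, and for every $a\in A$ its sum at $z=a$ equals $a(t)$ (the value of the polynomial $a$ at $\theta=t$).
   Context: $q$ is a power of a prime, $A=\mathbb{F}_q[\theta]$, $K=\mathbb{F}_q(\theta)$, $K_\infty=\mathbb{F}_q((1/\theta))$ with absolute value normalized by $|\theta|=q$, and $\mathbb{C}_\infty$ the completion of an algebraic closure of $K_\infty$ with the extended absolute value. $A_+(d)$ is the set of monic polynomials of degree $d$, $A(d)$ the set of polynomials of degree $<d$ ($A(0)=\{0\}$); $D_d$ is the product of all monic polynomials of degree $d$, $L_d$ the lcm of all polynomials of degree $d$, $D_0=L_0=1$; $e_j(z):=\prod_{a\in A(j)}(z-a)$. For an indeterminate $t$, $\chi_t:A\to A[t]$ is the $\mathbb{F}_q$-algebra morphism with $\theta\mapsto t$, $M_j(\chi_t)(z):=\sum_{b\in A_+(j)}\chi_t(b)\prod_{a\in A_+(j)\setminus\{b\}}(z-a)\in A[t][z]$, and $b_j(\chi_t):=(-1)^j\frac{L_j}{D_j}M_j(\chi_t)(0)\in K[t]$; in the claim $b_j(\chi_t)$ is evaluated at the given $t\in\mathbb{C}_\infty$. *)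

(* Defs.v *)
From HB Require Import structures.
From mathcomp Require Import all_boot all_order all_algebra.
From mathcomp Require Import reals.
Set Implicit Arguments. Unset Strict Implicit. Unset Printing Implicit Defensive.
Import Order.TTheory GRing.Theory Num.Theory.
Local Open Scope ring_scope.

Section Carlitz.
Variable F : finFieldType.

Definition polys_lt (j : nat) : seq {poly F} := [seq Poly (tval s) | s : j.-tuple F].
Definition monic_deg (j : nat) : seq {poly F} :=
  [seq 'X^j + Poly (tval s) | s : j.-tuple F].
Definition polys_deg (j : nat) : seq {poly F} :=
  filter (fun p : {poly F} => size p == j.+1) (polys_lt j.+1).

Definition Dj (j : nat) : {poly F} := \prod_(a <- monic_deg j) a.

(* lcm of two polynomials (up to a unit), and L_j normalized to be monic *)
Definition lcmpoly (a b : {poly F}) : {poly F} := (a * b) %/ gcdp a b.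
Definition Lj (j : nat) : {poly F} :=
  let l := foldr lcmpoly 1 (polys_deg j) in (lead_coef l)^-1 *: l.

Variable C : fieldType.
Variable iota : {rmorphism F -> C}.

(* evaluation of a in A = F_q[theta] at theta := x in C; for x = th this is the
   embedding A -> C_infty, for x = t it is chi_t(a) evaluated at t, i.e. a(t). *)
Definition evA (x : C) (a : {poly F}) : C := (map_poly iota a).[x].

Definition bj (th t : C) (j : nat) : C :=
  (-1) ^+ j * (evA th (Lj j) / evA th (Dj j)) *
  \sum_(i < size (monic_deg j))
     evA t (nth 0 (monic_deg j) i) *
     \prod_(k < size (monic_deg j) | k != i) (0 - evA th (nth 0 (monic_deg j) k)).

Definition ej (th z : C) (j : nat) : C := \prod_(a <- polys_lt j) (z - evA th a).

Definition carlitz_term (th t z : C) (j : nat) : C := bj th t j * (ej th z j / evA th (Dj j)).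

Variable R : realType.
Variable abs : C -> R.

Definition nonarch_abs : Prop :=
  [/\ abs 0 = 0, forall x, abs x = 0 -> x = 0,
      forall x y, abs (x * y) = abs x * abs y &
      forall x y, abs (x + y) <= Num.max (abs x) (abs y)].

Definition seq_cvg (u : nat -> C) (l : C) : Prop :=
  forall eps : R, 0 < eps -> exists N : nat, forall n, (N <= n)%N -> abs (u n - l) < eps.

Definition complete_abs : Prop :=
  forall u : nat -> C,
    (forall eps : R, 0 < eps -> exists N : nat,
        forall m n, (N <= m)%N -> (N <= n)%N -> abs (u m - u n) < eps) ->
    exists l, seq_cvg u l.

Definition series_cvg (u : nat -> C) (l : C) : Prop :=
  seq_cvg (fun n => \sum_(j < n) u j) l.

Definition algebraic_over_K (th x : C) : Prop :=
  exists P : {poly {poly F}}, P != 0 /\ (map_poly (evA th) P).[x] = 0.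

(* algebraic elements over K are dense (C is the completion of an algebraic
   closure of K_infty) *)
Definition alg_dense (th : C) : Prop :=
  forall x : C, forall eps : R, 0 < eps -> exists y, algebraic_over_K th y /\ abs (x - y) < eps.

End Carlitz.

(* Main.v *)
Require Import Defs.
From HB Require Import structures.
From mathcomp Require Import all_boot all_order all_algebra.
From mathcomp Require Import all_fingroup all_solvable all_field.
From mathcomp Require Import reals zify ring.
Set Implicit Arguments. Unset Strict Implicit. Unset Printing Implicit Defensive.
Import Order.TTheory GRing.Theory Num.Theory.
Local Open Scope ring_scope.

(** Write q = #|F|, [i] = th^(q^i) - th, and let E_0 = X, E_(d+1) = (E_d^q - E_d) / [d+1].
    These F-linear polynomials satisfy E_d(th z) = th^(q^d) E_d(z) + E_(d-1)(z), so E_d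
    vanishes on polynomials of degree < d and equals 1 on monic ones of degree d. Counting
    roots, E_d = e_d / D_d and D_d (E_d - 1) is the product of the X - a, a monic of degree d.
    With beta_j = prod_(i<j) (t - th^(q^i)), the sum of the beta_j E_j(a) is F-linear in a
    and gets multiplied by t when a is multiplied by th, hence equals a(t). Since E_d' is the
    constant (-1)^d / ([1]...[d]), Lagrange interpolation at the monic polynomials of degree
    d identifies b_d with beta_d, provided L_d = [1]...[d]. Finally
    |E_(d+1)(z)| <= max(|E_d(z)|^q, |E_d(z)|) / q^(q^(d+1)) forces |E_d(z)| <= 1 eventually,
    after which the terms beta_d E_d(z) decay at least geometrically. *)

(** * Brackets and the Frobenius power maps over [F] *)

Definition carlitz_bracket (V : pzRingType) (q : nat) (x : V) (i : nat) : V :=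
  x ^+ (q ^ i) - x.

Definition bracket_prod (V : pzRingType) (q : nat) (x : V) (j : nat) : V :=
  \prod_(i < j) carlitz_bracket q x i.+1.

Lemma bracket_prodS (V : pzRingType) (q : nat) (x : V) (j : nat) :
  bracket_prod q x j.+1 = bracket_prod q x j * carlitz_bracket q x j.+1.
Proof. by rewrite /bracket_prod big_ord_recr. Qed.

Section Frobenius.
Variables (F : finFieldType) (V : comNzRingType) (f : {rmorphism F -> V}).

(** [F] is an elementary abelian p-group, so its order is a power of p, and [f] carries the
    characteristic p over to [V]. *)
Lemma pnat_card_pchar : [pchar V].-nat #|F|.
Proof.
have [p p_pr pF] := finPcharP F.
have pV : p \in [pchar V] by exact: rmorph_pchar pF.
rewrite (eq_pnat _ (pcharf_eq pV)).
by have /and3P[] := fin_ring_pchar_abelem pF; rewrite /pgroup cardsT.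
Qed.

Lemma exprD_card (x y : V) i :
  (x + y) ^+ (#|F| ^ i) = x ^+ (#|F| ^ i) + y ^+ (#|F| ^ i).
Proof. by rewrite exprDn_pchar // pnatX pnat_card_pchar. Qed.

(** Additivity applied to x + (-x) = 0 covers odd and even q at once. *)
Lemma exprN_card (x : V) i : (- x) ^+ (#|F| ^ i) = - x ^+ (#|F| ^ i).
Proof.
apply/eqP; rewrite -subr_eq0 opprK addrC -exprD_card subrr expr0n expn_eq0.
by rewrite -leqn0 leqNgt ltnW ?finNzRing_gt1.
Qed.

Lemma exprB_card (x y : V) i :
  (x - y) ^+ (#|F| ^ i) = x ^+ (#|F| ^ i) - y ^+ (#|F| ^ i).
Proof. by rewrite exprD_card exprN_card. Qed.

Lemma rmorph_expr_card (c : F) i : f c ^+ (#|F| ^ i) = f c.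
Proof.
elim: i => [|i IHi]; first by rewrite expn0 expr1.
by rewrite expnS exprM -rmorphXn expf_card.
Qed.

(** Since [i]^(q^j) = x^(q^(i+j)) - x^(q^j), the two summands telescope. *)
Lemma bracketD (x : V) i j :
  carlitz_bracket #|F| x (i + j) =
  carlitz_bracket #|F| x i ^+ (#|F| ^ j) + carlitz_bracket #|F| x j.
Proof. by rewrite exprB_card -exprM -expnD addrA subrK. Qed.

End Frobenius.

(** * Divisibility in F[X]: least common multiples and brackets *)

Lemma lcmpoly_mul_gcdp (F : finFieldType) (a b : {poly F}) :
  lcmpoly a b * gcdp a b = a * b.
Proof. by rewrite divpK // dvdp_mulr ?dvdp_gcdl. Qed.

Section FiniteFieldPoly.
Variable F : finFieldType.
Implicit Types (a b m f : {poly F}).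
Local Notation q := #|F|.
Local Notation "[ i ]" := (carlitz_bracket q ('X : {poly F}) i) (at level 0).

(** After multiplication by [gcdp a b] the left side says that a b divides gcd(m a, m b); nonzero
    factors then cancel. *)
Lemma dvdp_lcmpoly a b m : a != 0 -> (lcmpoly a b %| m) = (a %| m) && (b %| m).
Proof.
move=> a0; have g0 : gcdp a b != 0 by rewrite gcdp_eq0 negb_and a0.
rewrite -(dvdp_mul2r _ _ g0) lcmpoly_mul_gcdp (eqp_dvdr _ (mulp_gcdr _ _ _)).
rewrite dvdp_gcd [a * b]mulrC dvdp_mul2r // [b * a]mulrC andbC.
(* A zero b cannot be cancelled, but then both sides amount to m = 0. *)
have [-> | b0] := eqVneq b 0; last by rewrite dvdp_mul2r.
by rewrite !mulr0 dvdpp dvd0p; case: eqP => [->|]; rewrite ?dvdp0 ?andbF.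
Qed.

Lemma dvdp_foldr_lcmpoly (s : seq {poly F}) m : 0 \notin s ->
  (foldr (@lcmpoly F) 1 s %| m) = all (fun a => a %| m) s.
Proof.
elim: s => [|a s IHs] /=; first by rewrite dvd1p.
by rewrite inE negb_or eq_sym => /andP[a0 s0]; rewrite dvdp_lcmpoly ?IHs.
Qed.

Lemma irreducible_divisor a : (1 < size a)%N ->
  exists2 f, irreducible_poly f & f %| a.
Proof.
have [n] := ubnP (size a); elim: n a => // n IHn a san sa.
have [a_irr|] := boolP (irreducibleb a); first by exists a; [exact/irreducibleP|].
rewrite /irreducibleb sa /= => /forallPn[b]; rewrite negb_imply -dvdpE -ltnNge.
case/andP=> ba sb; have sba : (size b < size a)%N.
  by rewrite (leq_ltn_trans (size_npoly b)) // ltn_predL ltnW.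
have [|f f_irr fb] := IHn b _ sb; first exact: leq_trans sba _.
by exists f => //; exact: dvdp_trans ba.
Qed.


Lemma bracket_dvd_mul i k : [i] %| [(k * i)%N].
Proof.
elim: k => [|k IHk]; first by rewrite mul0n /carlitz_bracket expn0 expr1 subrr.
rewrite mulSn (bracketD (@polyC F)) dvdp_add //.
by apply: dvdp_exp => //; rewrite expn_gt0 (ltnW (finNzRing_gt1 F)).
Qed.

(** F[X]/(f) is a field with q^(deg f) elements, so raising to that power fixes the class of X. *)
Lemma irreducible_dvd_bracket f : irreducible_poly f -> f %| [(size f).-1].
Proof.
move=> f_irr; have f0 := irredp_neq0 f_irr.
(* The quotient field is built from a monic irreducible polynomial, hence the normalization. *)
pose h := (lead_coef f)^-1 *: f.
have lc0 : (lead_coef f)^-1 != 0 by rewrite invr_eq0 lead_coef_eq0.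
have eqhf : h %= f by rewrite eqp_scale.
have hI : monic_irreducible_poly h.
  split; last by rewrite monicE lead_coefZ mulVf // lead_coef_eq0.
  split; first by rewrite size_scale ?f_irr.1.
  move=> g sg; rewrite (eqp_dvdr _ eqhf) => /(f_irr.2 g sg) gf.
  by rewrite (eqp_trans gf) // eqp_sym.
rewrite -(eqp_dvdl _ eqhf) -(size_scale f lc0) -/h.
have /(congr1 (fun x => val x)) : in_qpoly h 'X ^+ (q ^ (size h).-1) = in_qpoly h 'X.
  by rewrite -(card_qfpoly hI); exact: (expf_card (in_qpoly h 'X : {poly %/ h with hI})).
rewrite -rmorphXn /= mk_monicE // => E.
by rewrite dvdpE /Pdiv.Ring.rdvdp Pdiv.RingMonic.rmodpB ?hI.2 // E subrr.
Qed.

(* Split off an irreducible factor f of degree d: f divides [d], and d divides one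
   of the d largest indices i, so that [d] divides the corresponding factor [i]. *)
Lemma dvdp_bracket_prod a : a != 0 -> a %| bracket_prod q 'X (size a).-1.
Proof.
have [n] := ubnP (size a); elim: n a => // n IHn a san a0.
have [sa1|sa1] := leqP (size a) 1.
  have : size a == 1 by rewrite eqn_leq sa1 size_poly_gt0.
  by rewrite size_poly_eq1 => /eqp_dvdl->; rewrite dvd1p.
have [f f_irr /dvdpP[b a_bf]] := irreducible_divisor sa1.
have f0 := irredp_neq0 f_irr; have sf := f_irr.1.
have b0 : b != 0 by apply: contraNneq a0 => b0; rewrite a_bf b0 mul0r.
set d := (size f).-1; set k := (size b).-1.
have d_gt0 : (0 < d)%N by rewrite /d -subn1 subn_gt0.
have sa : (size a).-1 = (k + d)%N.
  rewrite a_bf size_mul //; move: sf b0; rewrite -size_poly_gt0 /k /d.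
  by move: (size b) (size f); lia.
rewrite sa a_bf /bracket_prod big_split_ord /=.
rewrite dvdp_mul ?IHn //.
  by move: san sa d_gt0 sa1; rewrite /k; move: (size a) (size b) d => /=; lia.
(* This choice makes k + i + 1 the least multiple of d above k. *)
pose i := (d.-1 - k %% d)%N.
have id : (i < d)%N by rewrite /i; move: d_gt0; lia.
rewrite (bigD1 (Ordinal id)) //= dvdp_mulr //.
have -> : (k + i).+1 = ((k %/ d).+1 * d)%N.
  by rewrite mulSn [in LHS](divn_eq k d) /i; have := ltn_pmod k d_gt0; lia.
exact: dvdp_trans (irreducible_dvd_bracket f_irr) (bracket_dvd_mul _ _).
Qed.
End FiniteFieldPoly.

(** * Enumeration of polynomials of bounded degree and of monic polynomials *)

Section Enumeration.
Variable F : finFieldType.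
Implicit Types a : {poly F}.
Local Notation q := #|F|.

Lemma mem_polys_lt j a : (a \in polys_lt F j) = (size a <= j)%N.
Proof.
apply/mapP/idP => [[s _ ->]|sa]; first by rewrite (leq_trans (size_Poly _)) ?size_tuple.
exists [tuple a`_i | i < j]; first by rewrite mem_enum.
apply/polyP => i; rewrite coef_Poly.
have [ij|ji] := ltnP i j.
  by rewrite (nth_mktuple (fun k : 'I_j => a`_k) 0 (Ordinal ij)).
by rewrite !nth_default ?size_tuple // (leq_trans sa).
Qed.

Lemma uniq_polys_lt j : uniq (polys_lt F j).
Proof.
rewrite map_inj_uniq ?enum_uniq // => s1 s2 /polyP E; apply: eq_from_tnth => i.
by have := E i; rewrite !coef_Poly !(tnth_nth 0).
Qed.

Lemma size_polys_lt j : size (polys_lt F j) = (q ^ j)%N.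
Proof. by rewrite size_map -cardE card_tuple. Qed.

Lemma monic_degE j : monic_deg F j = [seq 'X^j + a | a <- polys_lt F j].
Proof. by rewrite /monic_deg /polys_lt -map_comp. Qed.

Lemma mem_monic_deg j a : a \in monic_deg F j -> size a = j.+1 /\ a`_j = 1.
Proof.
rewrite monic_degE => /mapP[b]; rewrite mem_polys_lt => sb ->.
rewrite size_polyDl size_polyXn ?ltnS //; split=> //.
by rewrite coefD coefXn eqxx nth_default ?addr0.
Qed.

Lemma uniq_monic_deg j : uniq (monic_deg F j).
Proof. by rewrite monic_degE map_inj_uniq ?uniq_polys_lt //; exact: addrI. Qed.

Lemma size_monic_deg j : size (monic_deg F j) = (q ^ j)%N.
Proof. by rewrite monic_degE size_map size_polys_lt. Qed.

Lemma monic_deg_polys_deg j : {subset monic_deg F j <= polys_deg F j}.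
Proof.
by move=> a /mem_monic_deg[sa _]; rewrite mem_filter mem_polys_lt sa eqxx leqnn.
Qed.

End Enumeration.

(** * Lagrange interpolation *)

(** Both sides have size at most n, so comparing them at the n distinct nodes suffices. At [x i]
    only the i-th summand survives, and its product is the derivative of the node polynomial there,
    namely k. *)
Lemma lagrange_const_deriv (K : fieldType) (n : nat) (x w : 'I_n -> K) (g : {poly K}) (k : K) :
  injective x -> (size g <= n)%N -> (forall i, g.[x i] = w i) ->
  (\prod_i ('X - (x i)%:P))^`() = k%:P ->
  \sum_i (w i)%:P * \prod_(j | j != i) ('X - (x j)%:P) = k *: g.
Proof.
move=> x_inj sg gx dP; apply/eqP; rewrite -subr_eq0; apply/eqP.
apply: (@roots_geq_poly_eq0 _ _ [seq x i | i <- enum 'I_n]).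
- apply/allP => _ /mapP[i _ ->].
  rewrite rootE hornerD hornerN hornerZ horner_sum (bigD1 i) //=.
  rewrite [X in _ + X - _]big1 ?addr0; last first.
    move=> j ji; rewrite hornerM horner_prod (bigD1 i) 1?eq_sym //= hornerXsubC subrr.
    by rewrite mul0r mulr0.
  have /(congr1 (fun p => p.[x i])) := dP.
  rewrite (bigD1 i) //= derivM derivXsubC mul1r hornerD [X in _ + X]hornerM.
  by rewrite hornerXsubC subrr mul0r addr0 hornerM !hornerC => ->; rewrite gx mulrC subrr eqxx.
- by rewrite map_inj_uniq ?enum_uniq.
- rewrite size_map size_enum_ord (leq_trans (size_polyD _ _)) // size_polyN geq_max.
  rewrite (leq_trans (size_scale_leq _ _)) // andbT.
  apply: (leq_trans (size_sum _ _ _)); apply/bigmax_leqP => i _.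
  rewrite mul_polyC (leq_trans (size_scale_leq _ _)) //.
  have : size (\prod_j ('X - (x j)%:P)) = n.+1.
    rewrite -(big_map x predT (fun y => 'X - y%:P)) size_prod_XsubC size_map.
    by rewrite /index_enum -enumT size_enum_ord.
  by rewrite (bigD1 i) //= size_monicM ?monicXsubC ?monic_neq0 ?monic_prod_XsubC //
    size_XsubC add2n => -[->].
Qed.

(** * The polynomials E_d: functional equation, roots and leading coefficient *)

Section CarlitzPoly.
Variables (F : finFieldType) (C : fieldType) (iota : {rmorphism F -> C}).
Local Notation q := #|F|.

HB.instance Definition _ (x : C) :=
  GRing.RMorphism.copy (evA iota x) (horner_eval x \o map_poly iota).

Lemma evAX (x : C) : evA iota x 'X = x.
Proof. by rewrite /evA map_polyX hornerX. Qed.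

Lemma evAC (x : C) c : evA iota x c%:P = iota c.
Proof. by rewrite /evA map_polyC hornerC. Qed.

Lemma evA_MXaddC (x : C) p c :
  evA iota x (p * 'X + c%:P) = x * evA iota x p + iota c.
Proof. by rewrite rmorphD rmorphM /= evAX evAC mulrC. Qed.

Lemma q_gt0 : (0 < q)%N. Proof. exact: ltnW (finNzRing_gt1 F). Qed.

Lemma natr_card : q%:R = 0 :> C.
Proof.
have : (1 : F) *+ q = 0 by rewrite -FinRing.zmodXgE -cardsT expg_cardG ?inE.
by move/(congr1 iota); rewrite rmorph_nat rmorph0.
Qed.

Variable th : C.
Local Notation br := (carlitz_bracket q th).

Lemma evA_bracket_prod d : evA iota th (bracket_prod q 'X d) = bracket_prod q th d.
Proof.
rewrite rmorph_prod; apply: eq_bigr => i _.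
by rewrite /carlitz_bracket rmorphB rmorphXn /= evAX.
Qed.

(* [carlitz_poly d] is e_d / D_d, see [ej_div_Dj]. *)
Fixpoint carlitz_poly (d : nat) : {poly C} :=
  if d is e.+1 then (br e.+1)^-1 *: (carlitz_poly e ^+ q - carlitz_poly e) else 'X.
Local Notation E := carlitz_poly.

Lemma carlitz_poly0E z : (E 0).[z] = z.
Proof. by rewrite hornerX. Qed.

Lemma carlitz_polySE d z : (E d.+1).[z] = ((E d).[z] ^+ q - (E d).[z]) / br d.+1.
Proof. by rewrite /= hornerZ hornerD hornerN horner_exp mulrC. Qed.

Lemma carlitz_polyD d x y : (E d).[x + y] = (E d).[x] + (E d).[y].
Proof.
elim: d => [|d IHd]; first by rewrite !hornerX.
rewrite !carlitz_polySE IHd -mulrDl; congr (_ / _).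
have := exprD_card iota (E d).[x] (E d).[y] 1; rewrite expn1 => ->.
by rewrite opprD addrACA.
Qed.

Lemma carlitz_polyZ d c x : (E d).[iota c * x] = iota c * (E d).[x].
Proof.
elim: d => [|d IHd]; first by rewrite !hornerX.
rewrite !carlitz_polySE IHd exprMn.
have := rmorph_expr_card iota c 1; rewrite expn1 => ->.
by rewrite -mulrBr mulrA.
Qed.

Lemma carlitz_poly0 d : (E d).[0] = 0.
Proof. by have := carlitz_polyZ d 0 0; rewrite rmorph0 !mul0r. Qed.

Lemma carlitz_poly1 d : (E d).[1] = (d == 0%N)%:R.
Proof.
case: d => [|d]; first by rewrite hornerX.
elim: d => [|d IHd]; rewrite carlitz_polySE; first by rewrite /= hornerX expr1n subrr mul0r.
by rewrite IHd expr0n gtn_eqF ?q_gt0 //= subrr mul0r.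
Qed.

Hypothesis br_neq0 : forall i, br i.+1 != 0.

Lemma bracket_prod_neq0 d : bracket_prod q th d != 0.
Proof. by apply/prodf_neq0 => i _; exact: br_neq0. Qed.

(** This is the transcendence of [th]: a nonzero polynomial divides a bracket product, whose value
    at [th] is nonzero. *)
Lemma evA_inj : injective (evA iota th).
Proof.
apply: raddf_inj => a; apply: contra_eq => a0.
have /dvdpP[b /(congr1 (evA iota th))] := dvdp_bracket_prod a0.
rewrite evA_bracket_prod rmorphM /= => E; apply: contraTneq (bracket_prod_neq0 (size a).-1).
by rewrite E => ->; rewrite mulr0 eqxx.
Qed.

Lemma carlitz_poly_theta d z :
  (E d.+1).[th * z] = th ^+ (q ^ d.+1) * (E d.+1).[z] + (E d).[z].
Proof.
elim: d => [|d IHd].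
  apply: (mulIf (br_neq0 0)); rewrite !carlitz_polySE /= !hornerX.
  rewrite divfK // mulrDl -mulrA divfK //.
  by rewrite /carlitz_bracket expn1 exprMn; ring.
apply: (mulIf (br_neq0 d.+1)).
rewrite [in LHS]carlitz_polySE divfK // mulrDl [in RHS]carlitz_polySE.
rewrite -mulrA divfK // IHd.
have := exprD_card iota (th ^+ (q ^ d.+1) * (E d.+1).[z]) (E d).[z] 1; rewrite expn1 => ->.
rewrite exprMn -exprM -expnSr.
(* The recursion read backwards eliminates the q-th power of E_d. *)
have -> : (E d).[z] ^+ q = (E d.+1).[z] * br d.+1 + (E d).[z].
  by rewrite carlitz_polySE divfK // subrK.
by rewrite /carlitz_bracket; ring.
Qed.

(** Horner induction: for a = p X + c the functional equation leaves values at p of two consecutive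
    E's, both zero by induction, and a multiple of E_(d+1)(1) = 0. *)
Lemma carlitz_poly_small d (a : {poly F}) : (size a <= d)%N -> (E d).[evA iota th a] = 0.
Proof.
elim/poly_ind: a d => [|p c IHp] d; first by rewrite rmorph0 carlitz_poly0.
rewrite size_MXaddC; case: ifP => [/andP[/eqP-> /eqP->] _|_].
  by rewrite mul0r add0r polyC0 rmorph0 carlitz_poly0.
case: d => // d sp; rewrite evA_MXaddC carlitz_polyD.
rewrite carlitz_poly_theta -[iota c]mulr1 carlitz_polyZ carlitz_poly1 !IHp //.
  by rewrite !mulr0 !addr0.
exact: leqW.
Qed.

(** Same induction, but now the lower-index term of the functional equation survives and passes on
    the leading coefficient of p. *)
Lemma carlitz_poly_coef d (a : {poly F}) : (size a <= d.+1)%N ->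
  (E d).[evA iota th a] = iota a`_d.
Proof.
elim/poly_ind: a d => [|p c IHp] d; first by rewrite rmorph0 carlitz_poly0 coef0 rmorph0.
rewrite size_MXaddC; case: ifP => [/andP[/eqP-> /eqP->] _|_].
  by rewrite mul0r add0r polyC0 rmorph0 carlitz_poly0 coef0 rmorph0.
rewrite ltnS => sp; rewrite evA_MXaddC coefD coefMX coefC.
case: d sp => [|d] sp.
  by move: sp; rewrite leqn0 size_poly_eq0 => /eqP->; rewrite rmorph0 mulr0 !add0r hornerX.
rewrite carlitz_polyD carlitz_poly_theta -[iota c]mulr1 carlitz_polyZ carlitz_poly1.
by rewrite carlitz_poly_small // IHp // !mulr0 add0r !addr0.
Qed.

Lemma size_carlitz_poly d : size (E d) = (q ^ d).+1.
Proof.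
elim: d => [|d IHd]; first by rewrite /= size_polyX.
have sX : size (E d ^+ q) = (q ^ d.+1).+1.
  have := size_exp (E d) q; rewrite IHd /= -expnSr => <-.
  by rewrite prednK // size_poly_gt0 expf_neq0 // -size_poly_gt0 IHd.
rewrite /= size_scale ?invr_eq0 // size_polyDl ?size_polyN ?sX ?IHd // ltnS.
by rewrite ltn_exp2l ?finNzRing_gt1.
Qed.

(** The q-th power has zero derivative, so each step of the recursion only contributes the factor
    -1/[d+1]. *)
Lemma deriv_carlitz_poly d : (E d)^`() = ((-1) ^+ d / bracket_prod q th d)%:P.
Proof.
elim: d => [|d IHd]; first by rewrite /= derivX /bracket_prod big_ord0 divr1.
rewrite /= derivZ derivB deriv_exp -mulr_natr -polyC_natr natr_card mulr0 sub0r IHd.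
rewrite -polyCN -mul_polyC -polyCM bracket_prodS exprS; congr (_%:P).
by rewrite invfM; ring.
Qed.

Lemma map_evA_uniq (s : seq {poly F}) : uniq s -> uniq [seq evA iota th a | a <- s].
Proof. by rewrite map_inj_uniq //; exact: evA_inj. Qed.

Lemma carlitz_poly_lt_prod d : E d = lead_coef (E d) *:
  \prod_(a <- polys_lt F d) ('X - (evA iota th a)%:P).
Proof.
rewrite -(big_map (evA iota th) predT (fun x => 'X - x%:P)).
apply: all_roots_prod_XsubC.
- by rewrite size_map size_polys_lt size_carlitz_poly.
- apply/allP => x /mapP[a]; rewrite mem_polys_lt => sa ->.
  by rewrite rootE carlitz_poly_small.
- by rewrite uniq_rootsE map_evA_uniq ?uniq_polys_lt.
Qed.

(** The q^d monic polynomials of degree d give distinct roots, as many as the degree allows. *)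
Lemma carlitz_poly_monic_prod d : E d - 1 = lead_coef (E d) *:
  \prod_(a <- monic_deg F d) ('X - (evA iota th a)%:P).
Proof.
have s1 : (size (- 1 : {poly C})%R < size (E d))%N.
  by rewrite size_carlitz_poly size_polyN size_poly1 ltnS expn_gt0 q_gt0.
rewrite -(lead_coefDl s1) -(big_map (evA iota th) predT (fun x => 'X - x%:P)).
apply: all_roots_prod_XsubC.
- by rewrite size_map size_monic_deg size_polyDl // size_carlitz_poly.
- apply/allP => _ /mapP[a /mem_monic_deg[sa a1] ->].
  by rewrite rootE !hornerE carlitz_poly_coef ?sa // a1 rmorph1 subrr.
- by rewrite uniq_rootsE map_evA_uniq ?uniq_monic_deg.
Qed.

(** There are q^d factors, and (-1)^(q^d) = -1 in every characteristic. *)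
Lemma prodN_monic_deg d : \prod_(a <- monic_deg F d) (- a) = - Dj F d.
Proof.
rewrite /Dj (eq_bigr (fun a => -1 * a)) => [|a _]; last by rewrite mulN1r.
rewrite big_split /= big_const_seq count_predT size_monic_deg iter_mulr_1.
by rewrite exprN_card ?expr1n ?mulN1r //; exact: (@polyC F).
Qed.

(** Evaluate the factorization of E_d - 1 at 0, where E_d vanishes. *)
Lemma lead_coef_carlitz_poly d : lead_coef (E d) * evA iota th (Dj F d) = 1.
Proof.
have /(congr1 (fun p => p.[0])) := carlitz_poly_monic_prod d.
rewrite hornerD hornerN hornerC hornerZ carlitz_poly0 horner_prod add0r.
under eq_bigr => a _ do rewrite hornerXsubC sub0r -rmorphN.
by rewrite -rmorph_prod prodN_monic_deg rmorphN mulrN => /oppr_inj.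
Qed.

Lemma Dj_neq0 d : evA iota th (Dj F d) != 0.
Proof.
apply: contra_eq_neq (lead_coef_carlitz_poly d) => ->.
by rewrite mulr0 eq_sym oner_neq0.
Qed.

Lemma ej_div_Dj d z : ej iota th z d / evA iota th (Dj F d) = (E d).[z].
Proof.
rewrite carlitz_poly_lt_prod hornerZ horner_prod -[lead_coef _](mulfK (Dj_neq0 d)).
rewrite lead_coef_carlitz_poly div1r mulrC.
by congr (_ * _); apply: eq_bigr => a _; rewrite hornerXsubC.
Qed.


End CarlitzPoly.
Arguments carlitz_poly : simpl never.

(** * The finite expansion of a(t) and the closed form of b_j *)

Section CarlitzExpansion.
Variables (F : finFieldType) (C : fieldType) (iota : {rmorphism F -> C}).
Local Notation q := #|F|.
Variable th : C.
Local Notation br := (carlitz_bracket q th).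
Local Notation E := (carlitz_poly F th).
Hypothesis br_neq0 : forall i, br i.+1 != 0.

(** The closed form of b_j(chi_t), as [bjE] shows; called beta_j above. *)
Definition frob_prod (t : C) (j : nat) : C := \prod_(i < j) (t - th ^+ (q ^ i)).

Lemma frob_prodS t j : frob_prod t j.+1 = frob_prod t j * (t - th ^+ (q ^ j)).
Proof. by rewrite /frob_prod big_ord_recr. Qed.

(** Horner induction: in the sum at [th] times p, the coefficient of E_i(p) is beta_i th^(q^i) +
    beta_(i+1), which equals t beta_i. *)
Lemma carlitz_expansion t (a : {poly F}) n : (size a <= n)%N ->
  \sum_(j < n) frob_prod t j * (E j).[evA iota th a] = evA iota t a.
Proof.
elim/poly_ind: a n => [|p c IHp] n.
  by move=> _; rewrite !rmorph0 big1 // => j _; rewrite (carlitz_poly0 iota) mulr0.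
rewrite size_MXaddC; case: ifP => [/andP[/eqP-> /eqP->] _|_].
  rewrite mul0r add0r polyC0 !rmorph0 big1 // => j _.
  by rewrite (carlitz_poly0 iota) mulr0.
case: n => // n sp; rewrite !evA_MXaddC -(IHp n) //.
under eq_bigr => j _ do rewrite (carlitz_polyD iota) mulrDr.
rewrite big_split /=; congr (_ + _); last first.
  rewrite big_ord_recl big1 /= => [|j _].
    by rewrite /frob_prod big_ord0 mul1r carlitz_poly0E addr0.
  by rewrite -[iota c]mulr1 carlitz_polyZ carlitz_poly1 !mulr0.
rewrite big_ord_recl /= carlitz_poly0E.
under eq_bigr => j _ do rewrite /bump leq0n add1n (carlitz_poly_theta iota) // mulrDr.
rewrite big_split /= addrA.
have -> : frob_prod t 0 * (th * evA iota th p) + \sum_(i < n) frob_prod t i.+1 *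
    (th ^+ (q ^ i.+1) * (E i.+1).[evA iota th p]) =
    \sum_(i < n) th ^+ (q ^ i) * (frob_prod t i * (E i).[evA iota th p]).
  (* The extra term of index n vanishes because p has size at most n. *)
  transitivity (\sum_(i < n.+1) th ^+ (q ^ i) * (frob_prod t i * (E i).[evA iota th p])).
    rewrite big_ord_recl /= expn0 expr1 carlitz_poly0E mulrCA; congr (_ + _).
    by apply: eq_bigr => i _; rewrite /bump /= add1n mulrCA.
  by rewrite big_ord_recr /= carlitz_poly_small // !mulr0 addr0.
rewrite -big_split mulr_sumr; apply: eq_bigr => i _ /=.
by rewrite frob_prodS; ring.
Qed.

(** Evaluates the sum inside [bj] for arbitrary weights. It serves twice: with weights 1 to
    determine L_d, and with weights a(t) to determine b_d. *)
Lemma lagrange_monic_deg d (w : {poly F} -> C) (g : {poly C}) :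
  (size g <= q ^ d)%N ->
  (forall a, a \in monic_deg F d -> g.[evA iota th a] = w a) ->
  \sum_(i < size (monic_deg F d)) w (nth 0 (monic_deg F d) i) *
     \prod_(k < size (monic_deg F d) | k != i) (0 - evA iota th (nth 0 (monic_deg F d) k))
  = (-1) ^+ d * evA iota th (Dj F d) / bracket_prod q th d * g.[0].
Proof.
set s := monic_deg F d => sg gw.
have sz : size s = (q ^ d)%N by exact: size_monic_deg.
pose x (i : 'I_(size s)) := evA iota th (nth 0 s i).
have x_inj : injective x.
  move=> i j /(evA_inj br_neq0)/eqP; rewrite nth_uniq ?uniq_monic_deg //.
  by move/eqP/val_inj.
have gx i : g.[x i] = w (nth 0 s i) by rewrite gw // mem_nth.
have dP : (\prod_i ('X - (x i)%:P))^`() =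
    (evA iota th (Dj F d) * ((-1) ^+ d / bracket_prod q th d))%:P.
  have -> : \prod_i ('X - (x i)%:P) = evA iota th (Dj F d) *: (E d - 1).
    rewrite (carlitz_poly_monic_prod iota br_neq0) scalerA mulrC.
    rewrite lead_coef_carlitz_poly // scale1r.
    by rewrite (big_nth 0) big_mkord.
  by rewrite derivZ derivB derivC subr0 (deriv_carlitz_poly iota) // -mul_polyC -polyCM.
have sg' : (size g <= size s)%N by rewrite sz.
have /(congr1 (fun p => p.[0])) := lagrange_const_deriv x_inj sg' gx dP.
rewrite hornerZ horner_sum [_ * (_ / _)]mulrA [evA _ _ _ * _]mulrC => <-.
apply: eq_bigr => i _; rewrite hornerM hornerC horner_prod; congr (_ * _).
by apply: eq_bigr => k _; rewrite hornerXsubC.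
Qed.

(* Interpolating the constant 1 gives sum_(a monic of degree d) 1/a = (-1)^d / B,
   where B is the bracket product; multiplying by l shows that B divides l. *)
Lemma bracket_prod_dvd_lcm d (l : {poly F}) :
  (forall a, a \in monic_deg F d -> a %| l) -> bracket_prod q 'X d %| l.
Proof.
move=> dvl; set s := monic_deg F d.
have D0 : Dj F d != 0.
  by apply: contraNneq (Dj_neq0 iota br_neq0 d) => ->; rewrite rmorph0.
pose pr (i : 'I_(size s)) : {poly F} := \prod_(k < size s | k != i) (- nth 0 s k).
have prD (i : 'I_(size s)) : nth 0 s i * pr i = Dj F d.
  apply: oppr_inj; rewrite -prodN_monic_deg -/s (big_nth 0) big_mkord (bigD1 i) //=.
  by rewrite mulNr.
have sumpr : bracket_prod q 'X d * (\sum_i pr i) = (-1) ^+ d * Dj F d.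
  (* The identity is checked at [th], in a field where the bracket product can be inverted. *)
  apply: (evA_inj br_neq0 : injective (evA iota th)).
  rewrite rmorphM /= evA_bracket_prod rmorph_sum /=.
  have s1 : (size (1%:P : {poly C})%R <= q ^ d)%N.
    by rewrite size_polyC oner_neq0 expn_gt0 q_gt0.
  have := lagrange_monic_deg s1 (fun a _ => hornerC 1 (evA iota th a)).
  rewrite -/s hornerC mulr1 => H.
  have -> : \sum_i evA iota th (pr i) = (-1) ^+ d * evA iota th (Dj F d) / bracket_prod q th d.
    rewrite -H; apply: eq_bigr => i _; rewrite mul1r rmorph_prod.
    by apply: eq_bigr => k _; rewrite rmorphN sub0r.
  rewrite mulrC divfK ?bracket_prod_neq0 // rmorphM rmorphXn rmorphN rmorph1 //.
pose c (i : 'I_(size s)) := l %/ nth 0 s i.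
have lpr (i : 'I_(size s)) : l * pr i = c i * Dj F d.
  by rewrite -(prD i) mulrA /c divpK // dvl ?mem_nth.
have : bracket_prod q 'X d * (\sum_i c i) = (-1) ^+ d * l.
  apply: (mulIf D0); rewrite -mulrA mulr_suml.
  under eq_bigr do rewrite -lpr.
  by rewrite -mulr_sumr mulrCA sumpr; ring.
move=> H; have : bracket_prod q 'X d %| (-1) ^+ d * l by rewrite -H dvdp_mulr.
by rewrite -polyCN -polyC_exp mul_polyC dvdpZr // expf_neq0 // oppr_eq0 oner_neq0.
Qed.

(** The lcm and the bracket product divide each other, and both become monic after the normalization
    in [Lj], hence they agree. *)
Lemma evA_Lj d : evA iota th (Lj F d) = bracket_prod q th d.
Proof.
pose B : {poly F} := bracket_prod q 'X d.
rewrite -(evA_bracket_prod iota) -/B; congr (evA _ _ _).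
have nz0 : 0 \notin polys_deg F d by rewrite mem_filter size_poly0.
have eqB : foldr (@lcmpoly F) 1 (polys_deg F d) %= B.
  rewrite /eqp dvdp_foldr_lcmpoly //; apply/andP; split.
    apply/allP => a; rewrite mem_filter => /andP[/eqP sa _].
    have a0 : a != 0 by rewrite -size_poly_gt0 sa.
    by have := dvdp_bracket_prod a0; rewrite sa.
  apply: bracket_prod_dvd_lcm => a /monic_deg_polys_deg sa.
  have := dvdpp (foldr (@lcmpoly F) 1 (polys_deg F d)).
  by rewrite dvdp_foldr_lcmpoly // => /allP/(_ _ sa).
have mB : B \is monic.
  rewrite monic_prod // => i _; rewrite monicE lead_coefDl ?lead_coefXn //.
  rewrite size_polyXn size_polyN size_polyX ltnS (leq_trans (finNzRing_gt1 F)) //.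
  by rewrite expnS leq_pmulr // expn_gt0 q_gt0.
have := eqp_eq eqB; rewrite (monicP mB) scale1r => lE.
have l0 : lead_coef (foldr (@lcmpoly F) 1 (polys_deg F d)) != 0.
  rewrite lead_coef_eq0; apply: contraTneq eqB => ->.
  by rewrite eqp_sym eqp0 monic_neq0.
by rewrite /Lj [X in _ *: X]lE scalerA mulVf ?scale1r.
Qed.

Lemma bjE t d : bj iota th t d = frob_prod t d.
Proof.
rewrite /bj evA_Lj.
(* The expansion of a(t) with E_d(a) replaced by its value 1 at monic a of degree d: this brings the
   degree below q^d, as interpolation requires, and makes g(0) equal to beta_d. *)
pose g := (frob_prod t d)%:P + \sum_(j < d) frob_prod t j *: E j.
rewrite (@lagrange_monic_deg d (evA iota t) g).
- have -> : g.[0] = frob_prod t d.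
    rewrite hornerD hornerC horner_sum big1 ?addr0 // => j _.
    by rewrite hornerZ (carlitz_poly0 iota) mulr0.
  have := Dj_neq0 iota br_neq0 d; have := bracket_prod_neq0 br_neq0 d.
  move: (evA _ _ _) (bracket_prod _ _ _) => x y y0 x0.
  by rewrite !mulrA -signr_odd; case: odd; field; rewrite x0 y0.
- rewrite (leq_trans (size_polyD _ _)) // geq_max.
  rewrite (leq_trans (size_polyC_leq1 _)) ?expn_gt0 ?q_gt0 //=.
  apply: (leq_trans (size_sum _ _ _)); apply/bigmax_leqP => j _.
  rewrite (leq_trans (size_scale_leq _ _)) // size_carlitz_poly //.
  by rewrite ltn_exp2l ?finNzRing_gt1.
- move=> a /mem_monic_deg[sa a1]; rewrite -(carlitz_expansion t (n := d.+1)) ?sa //.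
  rewrite big_ord_recr /= carlitz_poly_coef ?sa // a1 rmorph1 mulr1 addrC.
  rewrite hornerD hornerC horner_sum; congr (_ + _).
  by apply: eq_bigr => j _; rewrite hornerZ.
Qed.

Lemma carlitz_termE t z j : carlitz_term iota th t z j = frob_prod t j * (E j).[z].
Proof. by rewrite /carlitz_term bjE (ej_div_Dj iota). Qed.

End CarlitzExpansion.

(** * Nonarchimedean absolute values and convergence of series *)

Section Nonarchimedean.
Variables (C : closedFieldType) (R : realType) (abs : C -> R).
Hypothesis absP : nonarch_abs abs.

Lemma nabs0 : abs 0 = 0. Proof. by case: absP. Qed.
Lemma nabs_eq0 x : abs x = 0 -> x = 0. Proof. by case: absP => _ H _ _; exact: H. Qed.
Lemma nabsM x y : abs (x * y) = abs x * abs y. Proof. by case: absP. Qed.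
Lemma nabsD x y : abs (x + y) <= Num.max (abs x) (abs y). Proof. by case: absP. Qed.

Lemma nabs1 : abs 1 = 1.
Proof.
have n0 : abs 1 != 0.
  by apply/eqP => /nabs_eq0/eqP; rewrite oner_eq0.
by apply: (mulfI n0); rewrite -nabsM !mulr1.
Qed.

(* [nonarch_abs] does not require abs to be nonnegative, but every element is a square. *)
Lemma nabs_ge0 x : 0 <= abs x.
Proof.
have /closed_rootP[y] : size ('X^2 - x%:P) != 1%N by rewrite size_XnsubC.
rewrite rootE !hornerE subr_eq0 => /eqP <-.
by rewrite nabsM -expr2 sqr_ge0.
Qed.

Lemma nabsN x : abs (- x) = abs x.
Proof.
have : abs (-1) ^+ 2 == 1 by rewrite expr2 -nabsM mulrNN mulr1 nabs1.
by rewrite sqrp_eq1 ?nabs_ge0 // => /eqP N1; rewrite -mulN1r nabsM N1 mul1r.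
Qed.

Lemma nabsX x n : abs (x ^+ n) = abs x ^+ n.
Proof.
elim: n => [|n IHn]; first by rewrite !expr0 nabs1.
by rewrite !exprS nabsM IHn.
Qed.

Lemma nabsB x y : abs (x - y) <= Num.max (abs x) (abs y).
Proof. by rewrite -[abs y]nabsN nabsD. Qed.

Lemma nabsV x : abs x^-1 = (abs x)^-1.
Proof.
have [->|x0] := eqVneq x 0; first by rewrite invr0 nabs0 invr0.
have ax0 : abs x != 0 by apply/eqP => /nabs_eq0/eqP; exact/negP.
by apply: (mulfI ax0); rewrite -nabsM !divff // nabs1.
Qed.

(** In the ultrametric inequality for x = (x - y) + y, the maximum cannot be [abs y]. *)
Lemma nabsB_ge x y : abs y < abs x -> abs x <= abs (x - y).
Proof.
move=> yx; have := nabsD (x - y) y; rewrite subrK le_max => /orP[//|xy].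
by move: (le_lt_trans xy yx); rewrite ltxx.
Qed.

Lemma nabs_sum_lt (u : nat -> C) (e : R) N n : 0 < e ->
  (forall j, (N <= j)%N -> abs (u j) < e) ->
  abs (\sum_(N <= j < n) u j) < e.
Proof.
move=> e0 ue; elim: n => [|n IHn]; first by rewrite big_geq // nabs0.
have [Nn|nN] := leqP N n; last by rewrite big_geq // nabs0.
rewrite big_nat_recr //=; apply: le_lt_trans (nabsD _ _) _.
by rewrite gt_max IHn ue.
Qed.

(** By the ultrametric inequality a block of small terms has a small sum, so the partial sums are
    Cauchy. *)
Lemma series_cvg_null (u : nat -> C) : complete_abs abs ->
  (forall e : R, 0 < e -> exists N, forall j, (N <= j)%N -> abs (u j) < e) ->
  exists l, series_cvg abs u l.
Proof.
move=> cpl u0; apply: cpl => e e0; have [N uN] := u0 e e0; exists N => m n.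
wlog mn : m n / (n <= m)%N.
  move=> H; have [nm|/ltnW mn] := leqP n m; first exact: H.
  by move=> Nm Nn; rewrite -nabsN opprB; exact: H.
move=> _ Nn; rewrite -!(big_mkord xpredT u) (@big_cat_nat _ _ _ n) //= [X in abs X]addrC addKr.
by apply: nabs_sum_lt => // j nj; apply: uN; exact: leq_trans nj.
Qed.

Lemma geometric_null (u : nat -> C) N :
  (forall j, (N <= j)%N -> abs (u j.+1) <= abs (u j) / 2) ->
  forall e : R, 0 < e -> exists M, forall j, (M <= j)%N -> abs (u j) < e.
Proof.
move=> uN e e0.
(* Since k + 1 <= 2^k, halving gives decay like 1/(k+1), which the Archimedean property handles
   directly. *)
have uk k : abs (u (N + k)%N) * k.+1%:R <= abs (u N).
  suff H : abs (u (N + k)%N) * 2 ^+ k <= abs (u N).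
    apply: le_trans H; rewrite ler_wpM2l ?nabs_ge0 // -natrX ler_nat.
    exact: ltn_expl.
  elim: k => [|k IHk]; first by rewrite addn0 expr0 mulr1.
  apply: le_trans IHk; rewrite addnS exprS mulrA ler_wpM2r ?exprn_ge0 //.
  by rewrite -ler_pdivlMr // uN // leq_addr.
pose k0 := Num.bound (abs (u N) / e).
exists (N + k0)%N => j /subnKC <-; rewrite -addnA; set k := (k0 + _)%N.
have k0k : (k0 <= k)%N by exact: leq_addr.
have Hk : abs (u N) / e < k.+1%:R.
  apply: lt_le_trans (archi_boundP _) _; first by rewrite divr_ge0 ?nabs_ge0 // ltW.
  by rewrite ler_nat -/k0 leqW.
have k1 : 0 < k.+1%:R :> R by rewrite ltr0n.
rewrite -(ltr_pM2r k1); apply: le_lt_trans (uk k) _.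
by rewrite -ltr_pdivrMl // mulrC.
Qed.

End Nonarchimedean.

(** * Size of E_d(z) and decay of the terms of the series *)

Section Estimates.
Variables (F : finFieldType) (C : closedFieldType) (iota : {rmorphism F -> C}).
Variables (R : realType) (abs : C -> R) (th : C).
Hypothesis absP : nonarch_abs abs.
Local Notation q := #|F|.
Hypothesis abs_th : abs th = q%:R.
Local Notation E := (carlitz_poly F th).

Lemma abs_bracket_ge i : q%:R ^+ (q ^ i.+1) <= abs (carlitz_bracket q th i.+1).
Proof.
have q1 := finNzRing_gt1 F.
rewrite -abs_th -nabsX // nabsB_ge // nabsX // abs_th -[ltLHS]expr1 ltr_eXn2l ?ltr1n //.
by rewrite (leq_trans q1) // expnS leq_pmulr // expn_gt0 q_gt0.
Qed.

Lemma bracket_theta_neq0 i : carlitz_bracket q th i.+1 != 0.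
Proof.
apply/eqP => b0; have := abs_bracket_ge i; rewrite b0 nabs0 // leNgt.
by rewrite exprn_gt0 // ltr0n q_gt0.
Qed.

Lemma abs_carlitz_polyS d z : abs (E d.+1).[z] <=
  Num.max (abs (E d).[z] ^+ q) (abs (E d).[z]) / q%:R ^+ (q ^ d.+1).
Proof.
rewrite carlitz_polySE nabsM // nabsV //.
apply: ler_pM; rewrite ?invr_ge0 ?nabs_ge0 //; first by rewrite -nabsX ?nabsB.
rewrite lef_pV2 ?abs_bracket_ge // posrE ?exprn_gt0 ?ltr0n ?q_gt0 //.
by apply: lt_le_trans (abs_bracket_ge d); rewrite exprn_gt0 // ltr0n q_gt0.
Qed.

Lemma abs_carlitz_poly_bound m z : abs z <= q%:R ^+ m ->
  forall d, (d <= m)%N -> abs (E d).[z] <= q%:R ^+ (q ^ d * (m - d)).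
Proof.
move=> zm; elim=> [|d IHd] dm; first by rewrite carlitz_poly0E expn0 mul1n subn0.
apply: le_trans (abs_carlitz_polyS d z) _.
have qq : 0 < q%:R ^+ (q ^ d.+1) :> R by rewrite exprn_gt0 // ltr0n q_gt0.
rewrite ler_pdivrMr // -exprD -[X in (_ + X)%N]muln1 -mulnDr.
have -> : (m - d.+1 + 1 = m - d)%N by lia.
have {}IHd := IHd (ltnW dm).
rewrite ge_max; apply/andP; split.
  rewrite expnSr mulnAC exprM ler_pXn2r ?nnegrE ?nabs_ge0 ?exprn_ge0 ?q_gt0 //.
apply: le_trans IHd _; rewrite ler_eXn2l ?ltr1n ?finNzRing_gt1 //.
by rewrite leq_mul2r leq_exp2l ?finNzRing_gt1 // leqnSn orbT.
Qed.

Lemma carlitz_poly_abs_le1 z : exists m, forall d, (m <= d)%N -> abs (E d).[z] <= 1.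
Proof.
have q1 := finNzRing_gt1 F.
(* Any m with |z| <= q^m would do; here |z| < m <= q^m. *)
pose m := Num.bound (abs z).
have zm : abs z <= q%:R ^+ m.
  apply: ltW; apply: lt_le_trans (archi_boundP (nabs_ge0 absP z)) _.
  by rewrite -natrX ler_nat ltnW // ltn_expl.
exists m => d; elim: d => [|d IHd].
  by rewrite leqn0 => /eqP m0; rewrite carlitz_poly0E; move: zm; rewrite m0.
rewrite leq_eqVlt => /orP[/eqP md|md].
  by have := abs_carlitz_poly_bound zm (leqnn m); rewrite subnn muln0 expr0 md.
have {}IHd := IHd md; apply: le_trans (abs_carlitz_polyS d z) _.
rewrite ler_pdivrMr ?exprn_gt0 ?ltr0n ?q_gt0 // mul1r.
apply: (@le_trans _ _ 1); last by rewrite exprn_ege1 // ler1n q_gt0.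
by rewrite ge_max IHd exprn_ile1 ?nabs_ge0.
Qed.

Variable t : C.
Hypothesis abs_t : abs t < q%:R.

(** Once |E_j(z)| <= 1, the new factor of beta costs at most q^(q^j) while E gains q^(q^(j+1)). *)
Lemma carlitz_term_decay z : exists N, forall j, (N <= j)%N ->
  abs (frob_prod F th t j.+1 * (E j.+1).[z]) <= abs (frob_prod F th t j * (E j).[z]) / 2.
Proof.
have q1 := finNzRing_gt1 F.
have [N EN] := carlitz_poly_abs_le1 z; exists N => j /EN Ej.
have qq i : 0 < q%:R ^+ (q ^ i) :> R by rewrite exprn_gt0 // ltr0n q_gt0.
have tth : abs (t - th ^+ (q ^ j)) <= q%:R ^+ (q ^ j).
  apply: le_trans (nabsB absP _ _) _; rewrite nabsX // abs_th ge_max lexx andbT.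
  apply: le_trans (ltW abs_t) _; rewrite -[leLHS]expr1 ler_eXn2l ?ltr1n //.
  by rewrite expn_gt0 q_gt0.
have ES : abs (E j.+1).[z] <= abs (E j).[z] / q%:R ^+ (q ^ j.+1).
  apply: le_trans (abs_carlitz_polyS j z) _; rewrite ler_pM2r ?invr_gt0 //.
  rewrite ge_max lexx andbT -[leRHS]expr1 ler_wiXn2l ?nabs_ge0 ?q_gt0 //.
rewrite frob_prodS !nabsM // -!mulrA ler_wpM2l ?nabs_ge0 //.
apply: (@le_trans _ _ (q%:R ^+ (q ^ j) * (abs (E j).[z] / q%:R ^+ (q ^ j.+1)))).
  by apply: ler_pM; rewrite ?nabs_ge0.
rewrite mulrCA ler_wpM2l ?nabs_ge0 // ler_pdivrMr //.
rewrite -ler_pdivrMl ?invr_gt0 // invrK.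
(* The ratio 1/2 comes from 2 <= q and q^j + 1 <= q^(j+1). *)
apply: (@le_trans _ _ (q%:R * q%:R ^+ (q ^ j))).
  by rewrite ler_wpM2r ?(ltW (qq _)) // ler_nat.
by rewrite -exprS ler_eXn2l ?ltr1n // ltn_exp2l.
Qed.

End Estimates.

(* C with abs, th models C_infty: a complete, algebraically closed field with a
   nonarchimedean absolute value, containing F_q and theta with |theta| = q, in
   which the algebraic closure of K = F_q(theta) is dense. *)
Theorem theorem4p2p6 (F : finFieldType) (C : closedFieldType)
  (iota : {rmorphism F -> C}) (R : realType) (abs : C -> R) (th : C) :
  nonarch_abs abs -> complete_abs abs -> abs th = (#|F|%:R : R) ->
  alg_dense iota abs th ->
  forall t : C, abs t < (#|F|%:R : R) ->
    (forall z : C, exists l : C, series_cvg abs (carlitz_term iota th t z) l) /\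
    (forall a : {poly F},
        series_cvg abs (carlitz_term iota th t (evA iota th a)) (evA iota t a)).
Proof.
move=> absP cpl abs_th _ t abs_t.
have br0 := bracket_theta_neq0 absP abs_th.
split=> [z|a].
  apply: series_cvg_null => //.
  have [N EN] := carlitz_term_decay absP abs_th abs_t z.
  by apply: (@geometric_null _ _ _ absP _ N) => j jN; rewrite !carlitz_termE ?EN.
(* From index [size a] on the partial sums equal a(t) exactly, so the same rank works for every
   [e]. *)
move=> e e0; exists (size a) => n sn.
under eq_bigr => j _ do rewrite carlitz_termE //.
by rewrite carlitz_expansion // subrr nabs0.
Qed.
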